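(* Let $K$ be a field, $\Delta$ a simplicial complex on $[n]$, and $\Delta^*$ the simplicial complex whose facets are the minimal vertex covers of $\Delta$. Assume that $\Delta$ is a forest. Then the vertex cover algebras $A(\Delta)$ and $A(\Delta^* )$ are standard graded algebras.
   Context: $\mathbb{N}=\{0,1,2,\ldots\}$ and $[n]=\{1,\ldots,n\}$. A simplicial complex on $[n]$ is a collection of subsets of $[n]$ (faces) closed under taking subsets; its maximal faces are its facets, and $\mathcal{F}(\Delta)$ is the set of facets. Complexes have at least one facet and their facets are nonempty. A subcomplex of $\Delta$ means a simplicial complex all of whose facets are facets of $\Delta$. A vertex cover of $\Delta$ is a subset $C\subseteq[n]$ with $C\cap F\ne\emptyset$ for all $F\in\mathcal{F}(\Delta)$; minimal means minimal under inclusion. A facet $F$ of $\Delta$ is a leaf if either $F$ is the only facet of $\Delta$, or there exists $G\in\mathcal{F}(\Delta)$, $G\ne F$, such that $H\cap F\subseteq G\cap F$ for each $H\in\mathcal{F}(\Delta)$ with $H\ne F$. $\Delta$ is a forest if each subcomplex of $\Delta$ has a leaf. For $k\ge 0$, a vector $\mathbf{c}=(c_1,\ldots,c_n)\in\mathbb{N}^n$ is a $k$-cover of a simplicial complex $\Sigma$ on $[n]$ if $\sum_{i\in F}c_i\ge k$ for all $F\in\mathcal{F}(\Sigma)$. Let $S=K[x_1,\ldots,x_n]$, let $t$ be a new variable, and let $A_k(\Sigma)$ be the $K$-span of all monomials $x_1^{c_1}\cdots x_n^{c_n}t^k$ with $(c_1,\ldots,c_n)$ a $k$-cover of $\Sigma$.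 The vertex cover algebra is the graded $S$-algebra $A(\Sigma)=\bigoplus_{k\ge 0}A_k(\Sigma)\subseteq S[t]$ (so $A_0(\Sigma)=S$). It is called standard graded if it is generated over $S$ by $A_1(\Sigma)$. *)

(* Defs.v *)
From mathcomp Require Import all_boot all_order all_algebra.
From mathcomp Require Import mpoly.

Set Implicit Arguments.
Unset Strict Implicit.
Unset Printing Implicit Defensive.

Import GRing.Theory.
Local Open Scope ring_scope.

Section Complexes.
Variable n : nat.
Implicit Types (X : {set {set 'I_n}}) (A B C F G H : {set 'I_n}).

Definition maximal_faces X : {set {set 'I_n}} :=
  [set F | maxset (fun A => A \in X) F].

(* The vertex set [n] = {1, ..., n} is represented by 'I_n = {0, ..., n-1}.
   A vertex need not belong to any face.  The last two fields exclude the
   complexes without faces and the complex whose only face is set0. *)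
Record complex := Complex {
  faces : {set {set 'I_n}};
  faces_closed : forall A B, A \subset B -> B \in faces -> A \in faces;
  has_facet : exists F, F \in maximal_faces faces;
  facets_nonempty : forall F, F \in maximal_faces faces -> F != set0
}.

Definition facets (D : complex) : {set {set 'I_n}} := maximal_faces (faces D).

Definition subcomplex (E D : complex) : Prop := facets E \subset facets D.

Definition leaf (D : complex) F : Prop :=
  F \in facets D /\
  (facets D = [set F] \/
   exists G, [/\ G \in facets D, G != F &
     forall H, H \in facets D -> H != F -> H :&: F \subset G :&: F]).

Definition forest (D : complex) : Prop :=
  forall E : complex, subcomplex E D -> exists F, leaf E F.

Definition vertex_cover (D : complex) C : bool :=
  [forall F in facets D, C :&: F != set0].

Definition minimal_vertex_covers (D : complex) : {set {set 'I_n}} :=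
  [set C | minset (vertex_cover D) C].

Section Dual.
Variable D : complex.

Definition dual_faces : {set {set 'I_n}} :=
  [set A : {set 'I_n} | [exists C in minimal_vertex_covers D, A \subset C]].

Lemma dual_faces_closed A B :
  A \subset B -> B \in dual_faces -> A \in dual_faces.
Proof.
move=> AB; rewrite !inE => /exists_inP[C minC BC].
by apply/exists_inP; exists C => //; apply: subset_trans BC.
Qed.

Lemma maximal_dual_faces : maximal_faces dual_faces = minimal_vertex_covers D.
Proof.
apply/setP => F; apply/idP/idP.
  rewrite inE => /maxsetP[]; rewrite inE => /exists_inP[C minC FC] maxF.
  rewrite -(maxF C) // inE; apply/exists_inP; by exists C.
move=> minF; rewrite inE; apply/maxsetP; split.
  by rewrite inE; apply/exists_inP; exists F.
move=> B; rewrite inE => /exists_inP[C minC BC] FB.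
have FC := subset_trans FB BC.
move: minF minC; rewrite !inE => /minsetP[covF _] /minsetP[_ minC].
by apply/eqP; rewrite eqEsubset FB andbT (minC F covF FC).
Qed.

Lemma dual_has_facet : exists F, F \in maximal_faces dual_faces.
Proof.
have covT : vertex_cover D setT.
  by apply/forall_inP => F /facets_nonempty; rewrite setTI.
have [C minC _] := minset_exists covT.
by exists C; rewrite maximal_dual_faces inE.
Qed.

Lemma dual_facets_nonempty F : F \in maximal_faces dual_faces -> F != set0.
Proof.
rewrite maximal_dual_faces inE => /minsetp /forall_inP covF.
have [G facG] := has_facet D.
by apply: contraNneq (covF G facG) => ->; rewrite set0I.
Qed.

Definition dual : complex :=
  Complex dual_faces_closed dual_has_facet dual_facets_nonempty.

Lemma facets_dual : facets dual = minimal_vertex_covers D.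
Proof. exact: maximal_dual_faces. Qed.

End Dual.
End Complexes.

Inductive generated_subalgebra (R : comNzRingType) (B : algType R)
    (X : B -> Prop) : B -> Prop :=
| gen_mem x : X x -> generated_subalgebra X x
| gen_const (a : R) : generated_subalgebra X a%:A
| gen_add x y : generated_subalgebra X x -> generated_subalgebra X y ->
    generated_subalgebra X (x + y)
| gen_mul x y : generated_subalgebra X x -> generated_subalgebra X y ->
    generated_subalgebra X (x * y).

Section VertexCoverAlgebra.
Variables (K : fieldType) (n : nat) (D : complex n).

Definition is_cover (k : nat) (c : 'X_{1..n}) : Prop :=
  forall F, F \in facets D -> (k <= \sum_(i in F) c i)%N.

(* S[t] is {poly {mpoly K[n]}}, with t its indeterminate 'X; the monomial
   x^c t^k is 'X_[c] *: 'X^k. *)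
Definition cover_component (k : nat) (f : {poly {mpoly K[n]}}) : Prop :=
  exists s : seq (K * 'X_{1..n}),
    (forall ac, ac \in s -> is_cover k ac.2) /\
    f = \sum_(ac <- s) (ac.1 *: 'X_[ac.2]) *: 'X^k.

(* The sum of the components is direct since cover_component k lies in
   degree k in t. *)
Definition vertex_cover_algebra (f : {poly {mpoly K[n]}}) : Prop :=
  exists (N : nat) (g : nat -> {poly {mpoly K[n]}}),
    (forall k, cover_component k (g k)) /\ f = \sum_(k < N) g k.

Definition standard_graded : Prop :=
  forall f, vertex_cover_algebra f <->
            generated_subalgebra (cover_component 1) f.

End VertexCoverAlgebra.

(* Main.v *)
Require Import Defs.
From mathcomp Require Import all_boot all_order all_algebra.
From mathcomp Require Import mpoly zify.

(** Multiplying monomials adds covers, so the algebra of a complex is generated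
    in degree one as soon as every (k+1)-cover is the sum of a 1-cover and a
    k-cover ([splits_standard_graded]).  What has to be shown is this splitting
    property, for the facets of a forest and for the minimal vertex covers of a
    forest.

    Forests.  A leaf F of a family of pairwise incomparable sets has a free
    vertex, one that lies in no other member: take it outside the joint.
    Removing such an F and then colouring its free vertex against another
    vertex of F shows by induction that the vertices can be 2-coloured so that
    no set with at least two vertices is monochromatic ([bicolouring]); the
    same is true after restriction to any vertex set, because inclusions
    between restricted sets can be ignored.  Applied to weights, every weight b
    is a sum of two weights that are both positive on each set of b-weight at
    least 2 ([halving]).  Now write a k-cover as a sum of k arbitrary weights.
    If some set is missed by one of them, another one has weight at least 2 on
    it; halving the sum of these two misses strictly fewer sets in total, so
    the process ends with k 1-covers ([cover_decomposition]).

    Dual.  A k-cover c of the dual complex is a weight for which every vertex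
    cover of the forest costs at least k, and facets are 1-covers of the dual.
    So a facet F is needed whose removal from c lowers the cost of every vertex
    cover to no less than k - 1.  Lowering c as long as possible, we may assume
    that each vertex v with c(v) > 0 is in a vertex cover C of cost k.  Among
    the facets on which c is positive everywhere take a leaf F and a free
    vertex v of F.  Let D be a vertex cover meeting F in r vertices.  Then
    (r-1) C + D still covers F at least r times after (r-1) v has been removed,
    and v is in no other of these facets; the remaining facets can be covered
    at no cost.  By the first part the resulting r-cover is a sum of r
    1-covers, whose supports are vertex covers, so it costs at least r k.  Hence
    c(D) >= r k - (r-1) (k - c(v)) >= k + r - 1, and F costs D only r
    ([packing_step]). *)

Set Implicit Arguments.
Unset Strict Implicit.
Unset Printing Implicit Defensive.

(** * Families of sets all of whose subfamilies have a leaf *)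

Section Families.
Variable T : finType.
Implicit Types (E S : {set {set T}}) (A C D F G H W : {set T}).
Implicit Types (b c d w : T -> nat) (k r : nat).

(** Stated for arbitrary families, rather than complexes, so that subfamilies can
    be taken freely. *)
Definition leaf_of S F : Prop :=
  F \in S /\
  (S = [set F] \/
   exists G, [/\ G \in S, G != F &
     forall H, H \in S -> H != F -> H :&: F \subset G :&: F]).

Definition leafy E : Prop :=
  forall S, S \subset E -> S != set0 -> exists F, leaf_of S F.

Definition weight c A : nat := \sum_(i in A) c i.

Definition covers E k c : Prop := forall F, F \in E -> k <= weight c F.

Definition transversal E C : bool := [forall F in E, C :&: F != set0].

Lemma leq_weight c d A : (forall i, c i <= d i) -> weight c A <= weight d A.
Proof. by move=> cd; apply: leq_sum => i _. Qed.

Lemma weightD c d A : weight (fun i => c i + d i) A = weight c A + weight d A.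
Proof. exact: big_split. Qed.

Lemma leq_weight_mem c A i : i \in A -> c i <= weight c A.
Proof. by move=> iA; rewrite /weight (bigD1 i) //= leq_addr. Qed.

Lemma weightB c d A : (forall i, d i <= c i) ->
  weight (fun i => c i - d i) A = weight c A - weight d A.
Proof.
move=> dc; rewrite -[in RHS](_ : weight (fun i => c i - d i + d i) A = weight c A).
  by rewrite weightD addnK.
by apply: eq_bigr => i _; rewrite subnK.
Qed.

Lemma subset_weight c A C : A \subset C -> weight c A <= weight c C.
Proof.
move=> sAC; rewrite /weight [X in _ <= X](big_setID A) /= (setIidPr sAC).
exact: leq_addr.
Qed.

(** If the members are incomparable on [W], the leaf is not contained in its
    joint there; a vertex of the leaf outside the joint is in no other member. *)
Lemma free_vertex E S W : leafy E -> S \subset E -> S != set0 ->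
    (forall F, F \in S -> F :&: W != set0) ->
    (forall F H, F \in S -> H \in S -> F :&: W \subset H -> F = H) ->
  exists F v, [/\ F \in S, v \in F :&: W & forall H, H \in S -> v \in H -> H = F].
Proof.
move=> leafE SE S0 meetW anti; have [F [FS [SF | [G [GS GF joint]]]]] := leafE S SE S0.
  have /set0Pn[v vF] := meetW F FS; exists F, v; split=> // H.
  by rewrite SF => /set1P.
have /subsetPn[v vFW vG] : ~~ (F :&: W \subset G).
  by apply: contra GF => FG; rewrite (anti F G).
exists F, v; split=> // H HS vH; apply/eqP; apply: contraNT vG => HF.
have := subsetP (joint H HS HF) v; rewrite !inE vH.
by move: vFW; rewrite inE => /andP[-> _] /(_ isT)/andP[].
Qed.

(** A member containing another one on [W] is bichromatic as soon as the smaller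
    one is, so it can be dropped.  Otherwise drop a member with a free vertex:
    recolouring that vertex repairs it and affects no other member. *)
Lemma bicolouring E W S : leafy E -> S \subset E ->
    (forall F, F \in S -> 1 < #|F :&: W|) ->
  exists f : T -> bool, forall F, F \in S ->
    exists u v, [/\ u \in F :&: W, v \in F :&: W, f u & ~~ f v].
Proof.
move=> leafE; have [m] := ubnP #|S|.
elim: m S => // m IH S ltSm SE big.
have rem H : H \in S -> exists f : T -> bool, forall F, F \in S :\ H ->
    exists u v, [/\ u \in F :&: W, v \in F :&: W, f u & ~~ f v].
  move=> HS; apply: IH.
  - by move: ltSm; rewrite (cardsD1 H) HS.
  - exact: subset_trans (subsetDl _ _) SE.
  - by move=> F /setD1P[_ /big].
have [-> | S0] := eqVneq S set0; first by exists xpredT => F; rewrite inE.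
have [/exists_inP[F FS /exists_inP[H HS /andP[FH FWH]]] | anti] :=
    boolP [exists F in S, exists H in S, (F != H) && (F :&: W \subset H)].
  have [f fP] := rem H HS; exists f => G GS.
  have [-> | GH] := eqVneq G H; last by apply: fP; rewrite !inE GH.
  have [|u [v [uF vF fu fv]]] := fP F; first by rewrite !inE FH.
  have inH x : x \in F :&: W -> x \in H :&: W.
    by move=> xF; rewrite inE (subsetP FWH) //; case/setIP: xF.
  by exists u, v; split=> //; apply: inH.
have [F FS|F H FS HS FWH|F [x [FS xF free]]] := free_vertex (W := W) leafE SE S0.
- by rewrite -card_gt0 ltnW ?big.
- apply/eqP; apply: contraNT anti => FH; apply/exists_inP; exists F => //.
  by apply/exists_inP; exists H; rewrite ?FH.
have [f fP] := rem F FS.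
have [y yF yx] : exists2 y, y \in F :&: W & y != x.
  have := big F FS; rewrite (cardsD1 x) xF ltnS card_gt0 => /set0Pn[y].
  by rewrite in_setD1 => /andP[yx yF]; exists y.
(* The free vertex [x] of [F] gets the colour opposite to that of [y]. *)
exists (fun z => if z == x then ~~ f y else f z) => H HS.
have [-> | HF] := eqVneq H F.
  case fy: (f y).
    by exists y, x; split=> //; rewrite ?eqxx ?(negPf yx) ?fy.
  by exists x, y; split=> //; rewrite ?eqxx ?(negPf yx) ?fy.
have notx z : z \in H :&: W -> (z == x) = false.
  case/setIP=> zH _; apply/eqP => zx; case/eqP: HF; apply: free => //.
  by rewrite -zx.
have [|u [v [uH vH fu fv]]] := fP H; first by rewrite !inE HF.
by exists u, v; split; rewrite ?notx.
Qed.

(** A vertex of weight at least 2 can contribute to both halves; the colouring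
    decides only for the vertices of weight exactly 1. *)
Lemma halving E b : leafy E -> exists2 b', (forall i, b' i <= b i) &
  forall F, F \in E -> 1 < weight b F -> 0 < weight b' F < weight b F.
Proof.
move=> leafE; pose W := [set i | b i == 1].
pose S := [set F in E | 1 < #|F :&: W|].
have [||f fP] := @bicolouring E W S leafE.
- by apply/subsetP => F; rewrite inE => /andP[].
- by move=> F; rewrite inE => /andP[].
pose b' i := if b i == 1 then nat_of_bool (f i) else nat_of_bool (0 < b i).
have b'b i : b' i <= b i.
  by rewrite /b'; case: eqP => [->|_]; [case: (f i) | case: (b i)].
exists b' => // F FE bF.
suff [[u uF b'u] [v vF b'v]] :
    (exists2 u, u \in F & 0 < b' u) /\ (exists2 v, v \in F & b' v < b v).
  apply/andP; split; first exact: leq_trans b'u (leq_weight_mem _ uF).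
  rewrite /weight (bigD1 v) //= [X in _ < X](bigD1 v) //= -addSn leq_add //.
  exact: leq_sum.
have [/exists_inP[i iF bi] | small] := boolP [exists i in F, 1 < b i].
  by split; exists i; rewrite // /b' gtn_eqF // (ltnW bi).
have [|u [v [uF vF fu fv]]] := fP F.
  rewrite inE FE (leq_trans bF) // -sum1_card big_mkcond /= /weight big_mkcond.
  apply: leq_sum => i _; rewrite !inE; case: ifP => // iF /=.
  suff : b i <= 1 by case: (b i) => [|[]].
  by rewrite leqNgt; apply: contra small => bi; apply/exists_inP; exists i.
move: uF vF; rewrite !inE => /andP[uF /eqP bu] /andP[vF /eqP bv].
by split; [exists u | exists v]; rewrite // /b' ?bu ?bv ?fu ?(negPf fv).
Qed.

(** Kempe exchange: start from a sum with a single nonzero term and halve the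
    sum of two terms again and again, lowering the number of pairs formed by a
    term and a member on which this term vanishes. *)
Lemma cover_decomposition E k c : leafy E -> covers E k.+1 c ->
  exists a : 'I_k.+1 -> T -> nat,
    (forall i, \sum_j a j i = c i) /\ forall j, covers E 1 (a j).
Proof.
move=> leafE cov.
pose uncovered (a : 'I_k.+1 -> T -> nat) F := \sum_j (weight (a j) F == 0).
pose defect (a : 'I_k.+1 -> T -> nat) := \sum_(F in E) uncovered a F.
suff loop m a : defect a < m -> (forall i, \sum_j a j i = c i) ->
    exists a : 'I_k.+1 -> T -> nat,
      (forall i, \sum_j a j i = c i) /\ forall j, covers E 1 (a j).
  apply: (loop _ (fun j => if j == ord0 then c else fun=> 0)) (ltnSn _) _ => i.
  by rewrite (bigD1 ord0) //= big1 ?addn0 // => j /negPf->.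
elim: m a => // m IH a ltm suma.
have [/forall_inP done | ] :=
    boolP [forall F in E, [forall j, 0 < weight (a j) F]].
  by exists a; split=> // j F FE; apply: (forallP (done F FE)).
rewrite negb_forall_in => /exists_inP[F FE].
rewrite negb_forall => /existsP[j]; rewrite -eqn0Ngt => /eqP aj0.
have sumF G : \sum_l weight (a l) G = weight c G.
  by rewrite exchange_big /=; apply: eq_bigr => i _.
have [l al] : exists l, 1 < weight (a l) F.
  apply/existsP; apply: contraTT (cov F FE); rewrite negb_exists -leqNgt.
  move=> /forallP small; rewrite -sumF (bigD1 j) //= aj0 add0n.
  apply: (@leq_trans (\sum_(i < k.+1 | i != j) 1)).
    by apply: leq_sum => i _; rewrite leqNgt.
  by rewrite sum1_card cardC1 card_ord.
have lj : l != j by apply: contraTneq al => ->; rewrite aj0.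
pose b i := a j i + a l i; have [b' b'b half] := halving b leafE.
pose a' x := if x == j then b' else if x == l then fun i => b i - b' i else a x.
have a'j : a' j = b' by rewrite /a' eqxx.
have a'l : a' l = (fun i => b i - b' i) by rewrite /a' (negPf lj) eqxx.
have a'x x : x != j -> x != l -> a' x = a x.
  by rewrite /a' => /negPf-> /negPf->.
have split2 (d : 'I_k.+1 -> nat) : \sum_x d x =
    d j + d l + \sum_(x | (x != j) && (x != l)) d x.
  by rewrite (bigD1 j) //= (bigD1 l) //= addnA.
have rest G : \sum_(x | (x != j) && (x != l)) (weight (a' x) G == 0)
            = \sum_(x | (x != j) && (x != l)) (weight (a x) G == 0).
  by apply: eq_bigr => x /andP[xj xl]; rewrite a'x.
have weightb G : weight b G = weight (a j) G + weight (a l) G by exact: weightD.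
have leb G : weight b' G <= weight b G by exact: leq_weight.
(* Both halves are positive on a member of weight at least 2; on the others,
   any two terms with the same sum vanish equally often. *)
have step G : G \in E -> uncovered a' G <= uncovered a G.
  move=> /half halfG; rewrite /uncovered !split2 rest leq_add2r a'j a'l weightB //.
  by move: halfG (leb G); rewrite weightb; lia.
have stepF : uncovered a' F < uncovered a F.
  rewrite /uncovered !split2 rest ltn_add2r a'j a'l weightB //.
  by move: (half F FE) (leb F); rewrite weightb; lia.
apply: (IH a') => [|i].
  rewrite -ltnS; apply: leq_trans ltm; rewrite ltnS /defect (bigD1 F) //=.
  rewrite [X in _ < X](bigD1 F) //= -addSn leq_add //.
  by apply: leq_sum => G /andP[GE _]; apply: step.
rewrite -suma !split2 a'j a'l.
by congr (_ + _); [apply: subnKC | apply: eq_bigr => x /andP[xj xl]; rewrite a'x].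
Qed.

Lemma cover_split E k c : leafy E -> covers E k.+1 c ->
  exists2 a, (forall i, a i <= c i) &
    covers E 1 a /\ covers E k (fun i => c i - a i).
Proof.
move=> leafE /(cover_decomposition leafE)[a [suma cova]].
exists (a ord0) => [i|]; first by rewrite -suma (bigD1 ord0) //= leq_addr.
split=> // F FE.
have -> : weight (fun i => c i - a ord0 i) F = \sum_(j | j != ord0) weight (a j) F.
  rewrite exchange_big; apply: eq_bigr => i _.
  by rewrite -suma (bigD1 ord0) //= addKn.
apply: (@leq_trans (\sum_(j < k.+1 | j != ord0) 1)).
  by rewrite sum1_card cardC1 card_ord.
by apply: leq_sum => j _; apply: cova.
Qed.

(** An r-cover is a sum of r 1-covers, and the support of each of these is a
    transversal. *)
Lemma cover_cost E k w r b : leafy E ->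
    (forall C, transversal E C -> k <= weight w C) ->
  covers E r b -> r * k <= \sum_i b i * w i.
Proof.
move=> leafE cheap; elim: r b => // r IH b /(cover_split leafE)[a ab [cova covb]].
have -> : \sum_i b i * w i = \sum_i a i * w i + \sum_i (b i - a i) * w i.
  by rewrite -big_split; apply: eq_bigr => i _; rewrite /= -mulnDl subnKC.
rewrite mulSn leq_add //; last exact: IH.
apply: (@leq_trans (weight w [set i | 0 < a i])).
  apply: cheap; apply/forall_inP => F /cova; rewrite lt0n sum_nat_eq0.
  move=> /forall_inPn[i iF ai].
  by apply/set0Pn; exists i; rewrite !inE lt0n ai.
rewrite /weight big_mkcond; apply: leq_sum => i _; rewrite inE.
by case: (a i) => // m; rewrite mulSn leq_addr.
Qed.

Lemma weight_indicator A C : weight (fun i => i \in A) C = #|A :&: C|.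
Proof.
rewrite /weight -sum1_card big_mkcond [RHS]big_mkcond; apply: eq_bigr => i _.
by rewrite inE andbC; case: (i \in C); case: (i \in A).
Qed.

(** One step of the min-max theorem saying that the cheapest transversal costs as
    much as the largest number of members that can be packed into [c].  The first
    case lowers [c] at a vertex with slack; when there is none, a leaf is used. *)
Lemma packing_step E k c : leafy E -> set0 \notin E ->
    (forall C, transversal E C -> k.+1 <= weight c C) ->
  exists2 F, F \in E & (forall i, (i \in F) <= c i) /\
    forall C, transversal E C -> k <= weight (fun i => c i - (i \in F)) C.
Proof.
move=> leafE E0; have [m] := ubnP (weight c setT).
elim: m c => // m IH c ltm cheap.
have [/existsP[v /andP[cv /forall_inP slack]] | tight] := boolP [exists v,
    (0 < c v) && [forall (C | transversal E C),
      k.+1 <= weight (fun i => c i - (i == v)) C]].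
  have le1 i : (i == v) <= c i by case: eqP => // ->.
  have [|C trC|F FE [Fc Fk]] := IH (fun i => c i - (i == v)).
  - rewrite -ltnS; apply: leq_trans ltm; rewrite ltnS weightB // ltn_subrL.
    rewrite (leq_trans _ (leq_weight_mem _ (in_setT v))) ?eqxx //.
    exact: leq_trans cv (leq_weight_mem _ (in_setT v)).
  - exact: slack.
  exists F => //; split=> [i|C /Fk kC].
    by apply: leq_trans (Fc i) (leq_subr _ _).
  apply: leq_trans kC _; apply: leq_weight => i.
  by rewrite leq_sub2r // leq_subr.
(* Vertices of weight 0 come for free in a transversal, so only the members
   avoiding them, and among these the minimal ones, are relevant. *)
pose Z := [set i | c i == 0].
pose E1 := [set F in E | [disjoint F & Z]].
pose S := [set F | minset (fun A => A \in E1) F].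
have S_E1 F : F \in S -> F \in E1 by rewrite inE => /minsetp.
have weightZ : weight c Z = 0.
  by rewrite /weight big1 // => i; rewrite inE => /eqP.
have S0 : S != set0.
  have /exists_inP[F FE dF] : [exists F in E, [disjoint F & Z]].
    apply: contraT; rewrite negb_exists_in => /forall_inP meets.
    suff /cheap : transversal E Z by rewrite weightZ.
    by apply/forall_inP => F /meets; rewrite setIC setI_eq0.
  have F1 : F \in E1 by rewrite inE FE.
  by have [G minG _] := minset_exists F1; apply/set0Pn; exists G; rewrite inE.
have [||||F [v [FS vF free]]] := @free_vertex E S setT leafE.
- by apply/subsetP => F /S_E1; rewrite inE => /andP[].
- exact: S0.
- move=> F /S_E1; rewrite inE setIT => /andP[FE _].
  by apply: contraNneq E0 => <-.
- move=> F H FS HS; rewrite setIT => FH; move: HS; rewrite inE => /minsetP[_ minH].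
  exact: minH (S_E1 F FS) FH.
rewrite setIT in vF; have := S_E1 F FS; rewrite inE => /andP[FE dF].
have pos i : i \in F -> 0 < c i.
  by move=> iF; have := disjointFr dF iF; rewrite inE lt0n => ->.
exists F => //; split=> [i|D trD]; first by case: (boolP (i \in F)) => // /pos.
(* [v] has no slack: outside [v], some transversal costs at most [k]. *)
have [C trC Ck] : exists2 C, transversal E C & weight c (C :\ v) <= k.
  move: tight; rewrite negb_exists => /forallP/(_ v); rewrite pos //=.
  rewrite negb_forall_in => /exists_inP[C trC]; rewrite -ltnNge ltnS => Ck.
  exists C => //; apply: leq_trans Ck; rewrite /weight big_mkcond.
  rewrite [X in _ <= X]big_mkcond; apply: leq_sum => i _.
  by rewrite !inE; case: eqP => //= _; rewrite subn0.
pose r := #|D :&: F|; have r_gt0 : 0 < r by rewrite card_gt0 (forall_inP trD).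
(* The r-cover obtained from D and r - 1 copies of C by removing all copies of
   v coming from C; F is covered r times by D alone.  The vertices of weight 0
   deal with the members outside [E1]. *)
pose b i := (i \in D) + r.-1 * (i \in C :\ v) + r * (i \in Z).
have weightb A : weight b A =
    #|D :&: A| + r.-1 * #|(C :\ v) :&: A| + r * #|Z :&: A|.
  by rewrite !weightD -!weight_indicator /weight !big_distrr.
have covb_S G : G \in S -> r <= weight b G.
  move=> GS; have [-> | GF] := eqVneq G F.
    by rewrite weightb -addnA leq_addr.
  have vG : v \notin G by apply: contra GF => /free->.
  have GE : G \in E by have := S_E1 G GS; rewrite inE => /andP[].
  have -> : weight b G = #|D :&: G| + r.-1 * #|C :&: G| + r * #|Z :&: G|.
    rewrite weightb; congr (_ + _ * #|pred_of_set _| + _); apply/setP => i.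
    rewrite !inE.
    by case: eqVneq => [->|] //=; rewrite (negPf vG) andbF.
  have DG : 0 < #|D :&: G| by rewrite card_gt0 (forall_inP trD).
  have CG : 0 < #|C :&: G| by rewrite card_gt0 (forall_inP trC).
  rewrite -[X in X <= _](prednK r_gt0) -add1n.
  by apply: leq_trans (leq_addr _ _); rewrite leq_add // leq_pmulr.
have covb : covers E r b.
  move=> G GE; have [dG | mG] := boolP [disjoint G & Z].
    have G1 : G \in E1 by rewrite inE GE.
    have [H minH HG] := minset_exists G1.
    by apply: leq_trans (subset_weight _ HG); rewrite covb_S ?inE.
  rewrite weightb -[X in X <= _]muln1; apply: leq_trans (leq_addl _ _).
  by rewrite leq_mul2l card_gt0 setIC setI_eq0 mG orbT.
have := cover_cost leafE cheap covb.
have -> : \sum_i b i * c i = weight c D + r.-1 * weight c (C :\ v) + r * weight c Z.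
  rewrite /weight (big_mkcond (mem D)) (big_mkcond (mem (C :\ v))).
  rewrite (big_mkcond (mem Z)) !big_distrr -!big_split /=.
  have boolM (p : bool) x : p * x = if p then x else 0.
    by case: p; rewrite ?mul1n.
  by apply: eq_bigr => i _; rewrite !mulnDl -!mulnA !boolM.
rewrite weightZ muln0 addn0 weightB; last first.
  by move=> i; case: (boolP (i \in F)) => // /pos.
rewrite weight_indicator setIC -/r.
by move: r_gt0 (leq_mul (leqnn r.-1) Ck); case: (r) => [|q] //= _; nia.
Qed.

End Families.

(** * Splitting covers of a forest and of its dual *)

Import GRing.Theory.
Local Open Scope ring_scope.

Section Complexes.
Variable n : nat.
Implicit Types (D : complex n) (A F H : {set 'I_n}) (S : {set {set 'I_n}}).

Lemma facets_antichain D F H :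
  F \in facets D -> H \in facets D -> F \subset H -> F = H.
Proof.
rewrite !inE => /maxsetP[_ maxF] /maxsetP[HD _] FH.
by rewrite (maxF H).
Qed.

(** Forests are defined by means of complexes; this turns a subfamily of the
    facets into a subcomplex. *)
Lemma complex_of_facets D S : S \subset facets D -> S != set0 ->
  exists E : complex n, facets E = S.
Proof.
move=> SD S0; pose X := [set A : {set 'I_n} | [exists F in S, A \subset F]].
have inX F : F \in S -> F \in X.
  by move=> FS; rewrite inE; apply/exists_inP; exists F.
have closedX A (B : {set 'I_n}) : A \subset B -> B \in X -> A \in X.
  rewrite !inE => AB /exists_inP[F FS BF]; apply/exists_inP; exists F => //.
  exact: subset_trans BF.
have maxX : maximal_faces X = S.
  apply/setP => F; rewrite inE; apply/maxsetP/idP => [[FX maxF] | FS].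
    have := FX; rewrite inE => /exists_inP[H HS FH].
    by rewrite -(maxF H) // inX.
  split=> [|B]; first exact: inX.
  rewrite inE => /exists_inP[H HS BH] FB; apply/eqP.
  rewrite eqEsubset FB andbT; suff -> : F = H by [].
  by apply: (@facets_antichain D); rewrite ?(subsetP SD) // (subset_trans FB).
have facetX : exists F, F \in maximal_faces X.
  by rewrite maxX; apply/set0Pn.
have nonemptyX F : F \in maximal_faces X -> F != set0.
  by rewrite maxX => /(subsetP SD); apply: facets_nonempty.
by exists (Complex closedX facetX nonemptyX).
Qed.

Lemma forest_leafy D : forest D -> leafy (facets D).
Proof.
move=> forestD S SD S0; have [E facetsE] := complex_of_facets SD S0.
have [|F leafF] := forestD E; first by rewrite /subcomplex facetsE.
by exists F; rewrite -facetsE.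
Qed.

Definition splits D : Prop := forall k (c : 'X_{1..n}), is_cover D k.+1 c ->
  exists c1 c2, [/\ c = (c1 + c2)%MM, is_cover D 1 c1 & is_cover D k c2].

(** Passage from weight functions to exponent vectors. *)
Lemma function_splits D :
  (forall k (c : 'I_n -> nat), covers (facets D) k.+1 c ->
    exists2 a, (forall i, a i <= c i)%N &
      covers (facets D) 1 a /\ covers (facets D) k (fun i => c i - a i)%N) ->
  splits D.
Proof.
move=> split k c /split[a ac [cova covc]].
exists [multinom a i | i < n], [multinom (c i - a i)%N | i < n]; split.
- by apply/mnmP => i; rewrite mnmDE !mnmE subnKC.
- by move=> F FD; under eq_bigr do rewrite mnmE; apply: cova.
- by move=> F FD; under eq_bigr do rewrite mnmE; apply: covc.
Qed.

Lemma splits_forest D : forest D -> splits D.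
Proof.
move=> /forest_leafy leafD; apply: function_splits => k c.
exact: cover_split.
Qed.

(** The minimal vertex covers all meet a given facet [F], so the indicator of [F]
    is a 1-cover of the dual. *)
Lemma splits_dual D : forest D -> splits (dual D).
Proof.
move=> /forest_leafy leafD; apply: function_splits => k c.
rewrite facets_dual => cov.
have [||F FD [Fc Fk]] := @packing_step _ (facets D) k c leafD.
- by apply/negP => /facets_nonempty/eqP.
- move=> C trC; have [B minB BC] := minset_exists (P := vertex_cover D) trC.
  by apply: leq_trans (subset_weight _ BC); apply: cov; rewrite inE.
exists (fun i => nat_of_bool (i \in F)) => //.
split=> C; rewrite inE => /minsetp trC; last exact: Fk.
by rewrite weight_indicator setIC card_gt0 (forall_inP trC).
Qed.

End Complexes.

(** * From splitting covers to standard graded algebras *)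

Section Algebra.
Variables (K : fieldType) (n : nat) (D : complex n).
Implicit Types (f g h : {poly {mpoly K[n]}}) (c : 'X_{1..n}).

Local Notation term a c k := ((a *: 'X_[c]) *: 'X^k : {poly {mpoly K[n]}}).
Local Notation component := (@cover_component K n D).
Local Notation algebra := (@vertex_cover_algebra K n D).

Lemma component0 k : component k 0.
Proof. by exists [::]; split=> //; rewrite big_nil. Qed.

Lemma component_term k a c : is_cover D k c -> component k (term a c k).
Proof.
move=> cov; exists [:: (a, c)]; rewrite big_seq1; split=> // ac.
by rewrite inE => /eqP->.
Qed.

Lemma componentD k f g : component k f -> component k g -> component k (f + g).
Proof.
move=> [s [covs ->]] [t [covt ->]]; exists (s ++ t); rewrite big_cat; split=> // ac.
by rewrite mem_cat => /orP[/covs | /covt].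
Qed.

(** Components as spans of monomials: an additive property need only be checked
    on terms. *)
Lemma component_ind k (P : {poly {mpoly K[n]}} -> Prop) :
    P 0 -> (forall f g, P f -> P g -> P (f + g)) ->
    (forall a c, is_cover D k c -> P (term a c k)) ->
  forall f, component k f -> P f.
Proof.
move=> P0 PD Pt f [s [covs ->]]; rewrite big_seq.
by apply: big_ind => // ac /covs; apply: Pt.
Qed.

Lemma termM a b c d k l :
  term a c k * term b d l = term (a * b) (c + d)%MM (k + l).
Proof.
by rewrite -scalerAl -scalerAr scalerA exprD mpolyXD -scalerAl -scalerAr !scalerA.
Qed.

Lemma componentM k l f g :
  component k f -> component l g -> component (k + l) (f * g).
Proof.
move=> covf covg; elim/component_ind: f / covf => [|f h|a c covc].
- by rewrite mul0r; apply: component0.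
- by rewrite mulrDl; apply: componentD.
elim/component_ind: g / covg => [|f h|b d covd].
- by rewrite mulr0; apply: component0.
- by rewrite mulrDr; apply: componentD.
rewrite termM; apply: component_term => F FD.
under eq_bigr do rewrite mnmDE.
by rewrite big_split leq_add ?covc ?covd.
Qed.

Lemma component_algebra k f : component k f -> algebra f.
Proof.
move=> covf; exists k.+1, (fun l => if l == k then f else 0); split.
  by move=> l; case: eqP => [->|_]; [|apply: component0].
rewrite big_ord_recr /= eqxx big1 ?add0r // => i _.
by rewrite ltn_eqF.
Qed.

(** Both sums of components are padded by zeros to a common length. *)
Lemma algebraD f g : algebra f -> algebra g -> algebra (f + g).
Proof.
have pad N M (u : nat -> {poly {mpoly K[n]}}) : (N <= M)%N ->
    \sum_(k < N) u k = \sum_(k < M) if (k < N)%N then u k else 0.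
  by move=> NM; rewrite (big_ord_widen _ _ NM) big_mkcond.
move=> [N [u [covu ->]]] [M [v [covv ->]]].
rewrite (pad _ _ u (leq_maxl N M)) (pad _ _ v (leq_maxr N M)) -big_split.
exists (maxn N M), (fun k => (if (k < N)%N then u k else 0) +
  (if (k < M)%N then v k else 0)); split=> // k.
by apply: componentD; case: ifP => // _; apply: component0.
Qed.

Lemma algebra_sum (I : Type) (s : seq I) (P : pred I) u :
  (forall i, P i -> algebra (u i)) -> algebra (\sum_(i <- s | P i) u i).
Proof.
apply: big_ind; last exact: algebraD.
exact: component_algebra (component0 0).
Qed.

Lemma algebraM f g : algebra f -> algebra g -> algebra (f * g).
Proof.
move=> [N [u [covu ->]]] [M [v [covv ->]]]; rewrite big_distrlr /=.
apply: algebra_sum => i _; apply: algebra_sum => j _.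
by apply: component_algebra; apply: componentM.
Qed.

Lemma algebra_const (p : {mpoly K[n]}) : algebra p%:A.
Proof.
rewrite [X in X *: _]mpolyE scaler_suml; apply: algebra_sum => c _.
exact: (@component_algebra 0) (component_term _ _).
Qed.

Lemma generated_component k f : splits D -> component k f ->
  generated_subalgebra (component 1) f.
Proof.
move=> splitD; elim/component_ind: f / => [|f g|a c].
- by rewrite -(scale0r 1); apply: gen_const.
- exact: gen_add.
elim: k c => [|k IH] c; first by move=> _; apply: gen_const.
move=> /splitD[c1 [c2 [-> cov1 cov2]]].
rewrite -[a]mul1r -(add1n k) -termM; apply: gen_mul; last exact: IH.
by apply: gen_mem; apply: component_term.
Qed.

Lemma splits_standard_graded : splits D -> standard_graded K D.
Proof.
move=> splitD f; split=> [[N [u [covu ->]]] | ].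
  apply: big_ind => [|g h|k _].
  - by rewrite -(scale0r 1); apply: gen_const.
  - exact: gen_add.
  - exact: generated_component (covu k).
elim=> [g|p|g h _ algg _ algh|g h _ algg _ algh].
- exact: component_algebra.
- exact: algebra_const.
- exact: algebraD.
- exact: algebraM.
Qed.

End Algebra.

Theorem corollary3p3 (K : fieldType) (n : nat) (Delta : complex n)
    (hforest : forest Delta) :
  standard_graded K Delta /\ standard_graded K (dual Delta).
Proof.
split; apply: splits_standard_graded; first exact: splits_forest.
exact: splits_dual.
Qed.
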